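(* Let $A$ and $B$ be disjoint bases in a matroid $M$, let $a\in A$ and let $b\in Sym(a,A,B)$. Write $A_{a,b}=A-a+b$ and $B_{b,a}=B-b+a$ (both are bases). Then for any $a'\in A-a$: (i) If $b\notin C(a',B)$ and $a'\notin C(b,A)$, then $$Sym(a',A_{a,b},B_{b,a})=Sym(a',A,B).$$ (ii) If $b\in C(a',B)$ and $a'\notin C(b,A)$, then $$Sym(a',A,B)\bigtriangleup Conn(a,a',A,B)\subseteq Sym(a',A_{a,b},B_{b,a})\subseteq Sym(a',A,B)\cup Conn(a,a',A,B).$$ (iii) If $b\notin C(a',B)$ and $a'\in C(b,A)$, then $$Sym(a',A,B)\bigtriangleup Conn(a',a,A,B)\subseteq Sym(a',A_{a,b},B_{b,a})\subseteq Sym(a',A,B)\cup Conn(a',a,A,B).$$ (iv) If $b\in C(a',B)$ and $a'\in C(b,A)$, then $$\bigl(Sym(a',A,B)\bigtriangleup Sym(a,A,B)\bigtriangleup Conn(a',a,A,B)\bigtriangleup Conn(a,a',A,B)\bigr)+a\subseteq Sym(a',A_{a,b},B_{b,a})$$ and $$Sym(a',A_{a,b},B_{b,a})\subseteq \bigl(Sym(a',A,B)\cup Sym(a,A,B)\cup Conn(a',a,A,B)\cup Conn(a,a',A,B)\bigr)+a.$$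
   Context: Matroids have a finite ground set. For a set $X$ and an element $x$, $X+x=X\cup\{x\}$ and $X-x=X\setminus\{x\}$. For a basis $B$ of $M$ and an element $y\notin B$ of the ground set, $C(y,B)$ denotes the unique circuit contained in $B+y$. $X\bigtriangleup Y=(X\setminus Y)\cup(Y\setminus X)$ denotes symmetric difference. For disjoint bases $A,B$ of $M$ and $a\in A$, $Sym(a,A,B)=\{b\in B : A-a+b \text{ and } B-b+a \text{ are bases}\}$. For distinct $a,a'\in A$, $Conn(a,a',A,B)=\{b\in B : A-a'+b \text{ and } B-b+a \text{ are bases}\}$. *)

(* Defs.v *)
From mathcomp Require Import all_boot.

Set Implicit Arguments.
Unset Strict Implicit.
Unset Printing Implicit Defensive.

Record matroid (T : finType) := Matroid {
  indep : pred {set T};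
  indep0 : indep set0;
  indep_sub : forall I J : {set T}, J \subset I -> indep I -> indep J;
  indep_aug : forall I J : {set T}, indep I -> indep J -> #|I| < #|J| ->
    exists2 x, x \in J :\: I & indep (x |: I)
}.

Definition symdiff (T : finType) (X Y : {set T}) : {set T} :=
  (X :\: Y) :|: (Y :\: X).

Notation "X :+: Y" := (symdiff X Y) (at level 52, left associativity).

(* exchange X x y is X - x + y *)
Definition exchange (T : finType) (X : {set T}) (x y : T) : {set T} :=
  y |: (X :\ x).

Section MatroidTheory.
Variables (T : finType) (M : matroid T).
Implicit Types (A B C I J : {set T}) (a b y : T).

Definition basis B : bool := maxset (indep M) B.

Definition circuit C : bool := minset (fun X => ~~ indep M X) C.

(* The circuit C(y, B); meaningful when B is a basis and y \notin B, in which
   case it is the unique circuit contained in B + y (see [fund_circuitP]). *)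
Definition fund_circuit y B : {set T} :=
  odflt set0 [pick C | circuit C && (C \subset y |: B)].

Definition Sym a A B : {set T} :=
  [set b in B | basis (exchange A a b) && basis (exchange B b a)].

(* The element leaving A is a', the one entering B is a. *)
Definition Conn a a' A B : {set T} :=
  [set b in B | basis (exchange A a' b) && basis (exchange B b a)].

Lemma indep_extend I J : indep M I -> indep M J ->
  exists K : {set T}, [/\ I \subset K, K \subset I :|: J, indep M K & #|J| <= #|K|].
Proof.
move=> iI iJ; have [n] := ubnP (#|J| - #|I|).
elim: n I iI => // n IHn I iI ltn.
have [leJI | ltIJ] := leqP #|J| #|I|.
  by exists I; rewrite subxx subsetUl.
have [x /setDP[xJ xI] ixI] := indep_aug iI iJ ltIJ.
have [|K [IK KJ iK JK]] := IHn _ ixI.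
  rewrite cardsU1 xI add1n subnS prednK ?subn_gt0 //.
exists K; split=> //; first exact: subset_trans (subsetUr _ _) IK.
by apply: subset_trans KJ _; rewrite -setUA subUset sub1set !inE xJ orbT /=.
Qed.

Lemma fund_circuitP y B C : basis B -> y \notin B ->
  (circuit C && (C \subset y |: B)) = (C == fund_circuit y B).
Proof.
move=> /maxsetP[iB maxB] yB.
have depBy : ~~ indep M (y |: B).
  apply/negP=> /maxB/(_ (subsetUr _ _)) eBy.
  by case/negP: yB; rewrite -eBy setU11.
have uniqC C1 C2 : circuit C1 && (C1 \subset y |: B) ->
    circuit C2 && (C2 \subset y |: B) -> C1 = C2.
  move=> /andP[/minsetP[dC1 minC1] C1B] /andP[/minsetP[dC2 minC2] C2B].
  apply/eqP/negPn/negP=> neC.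
  have [C12 | /subsetPn[x xC1 xC2]] := boolP (C1 \subset C2).
    by case/eqP: neC; apply: minC2.
  have iC1x : indep M (C1 :\ x).
    apply/negPn/negP=> /minC1/(_ (subD1set _ _)) eC1.
    by move: xC1; rewrite -eC1 setD11.
  have [K [C1K KB iK BK]] := indep_extend iC1x iB.
  have KBy : K \subset y |: B.
    apply: subset_trans KB _; rewrite subUset subsetUr andbT.
    exact: subset_trans (subD1set _ _) C1B.
  have xK : x \notin K.
    apply: contra dC1 => xK; apply: indep_sub iK.
    by rewrite -(setD1K xC1) subUset sub1set xK.
  have xBy : x \in y |: B by apply: (subsetP C1B).
  have eK : K = (y |: B) :\ x.
    apply/eqP; rewrite eqEcard subsetD1 KBy xK /=.
    by move/eqP: (cardsD1 x (y |: B)); rewrite xBy cardsU1 yB eqn_add2l => /eqP<-.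
  case/negP: dC2; apply: indep_sub iK.
  by rewrite eK subsetD1 C2B xC2.
rewrite /fund_circuit; case: pickP => [D cD | noC] /=.
  by apply/idP/eqP=> [cC | ->//]; apply: uniqC.
have [D mD DB] := minset_exists (P := fun X => ~~ indep M X) depBy.
by have := noC D; rewrite /circuit mD DB.
Qed.

End MatroidTheory.

(* Main.v *)
Require Import Defs.
From mathcomp Require Import all_boot.

Set Implicit Arguments.
Unset Strict Implicit.
Unset Printing Implicit Defensive.

(** Write [p x y] for "[B - x + y] is a basis". If [p x y] holds, then
    "[B - x - x' + y + z] is a basis" behaves like the non-vanishing of the
    determinant [p x y * p x' z - p x z * p x' y]: it holds when exactly one of
    the two products is non-zero, and fails when both vanish. In the contraction
    by [B - x - x'], which has rank 2, this is the transitivity of parallelism.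
    Applying it in [A] and in [B] and multiplying out gives the four cases. *)

Section Exchange.
Variables (T : finType) (M : matroid T).
Implicit Types (B D X : {set T}) (x y z u v w : T).

Lemma basis_card B X : basis M B -> basis M X = indep M X && (#|X| == #|B|).
Proof.
have le_card I J : indep M I -> basis M J -> #|I| <= #|J|.
  move=> iI /maxsetP[iJ maxJ]; have [K [JK _ iK le_IK]] := indep_extend iJ iI.
  by rewrite -(maxJ K iK JK).
move=> bB; apply/idP/andP=> [bX | [iX /eqP eXB]].
  have [/maxsetP[iB _] /maxsetP[iX _]] := (bB, bX).
  by rewrite iX eqn_leq !le_card.
apply/maxsetP; split=> // Y iY XY; apply/esym/eqP.
by rewrite eqEcard XY eXB le_card.
Qed.

Lemma card_exchange X x y : x \in X -> y \notin X -> #|exchange X x y| = #|X|.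
Proof.
by move=> xX yX; rewrite cardsU1 !inE (negbTE yX) andbF (cardsD1 x X) xX.
Qed.

Lemma basis_exchange B x y : basis M B -> x \in B -> y \notin B ->
  basis M (exchange B x y) = indep M (exchange B x y).
Proof.
by move=> bB xB yB; rewrite (basis_card _ bB) card_exchange // eqxx andbT.
Qed.

(** Deleting [x] from [y |: B] leaves a dependent set exactly when some circuit in [y |: B] avoids
    [x], and that circuit is unique. This turns the hypotheses of the four cases into values of
    p. *)
Lemma mem_fund_circuit B x y : basis M B -> x \in B -> y \notin B ->
  (x \in fund_circuit M y B) = basis M (exchange B x y).
Proof.
move=> bB xB yB.
have xy : x != y by apply: contraNneq yB => <-.
have /andP[cC CBy] : circuit M (fund_circuit M y B)
    && (fund_circuit M y B \subset y |: B) by rewrite fund_circuitP.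
have eBxy : exchange B x y = (y |: B) :\ x.
  by apply/setP=> t; rewrite !inE; case: eqP => // ->; rewrite eq_sym (negbTE xy).
rewrite basis_exchange // eBxy; apply/idP/idP=> [xC | iBxy].
  apply/negPn/negP=> dep.
  have [C' cC' C'B] := minset_exists (P := fun X => ~~ indep M X) dep.
  have := fund_circuitP C' bB yB.
  rewrite /circuit cC' (subset_trans C'B (subD1set _ _)) => /esym/eqP eC'.
  by move: xC; rewrite -eC' => /(subsetP C'B); rewrite !inE eqxx.
apply/negPn/negP=> xC; have /minsetP[/negP dC _] := cC.
by apply: dC; apply: indep_sub iBxy; rewrite subsetD1 CBy.
Qed.

(** Over [D], a non-loop [v] cannot be parallel to both members of an independent pair: augmenting
    [v |: D] from the larger set must add [u] or [w]. *)
Lemma indep_pair_trans D u v w :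
  u != w -> u \notin D -> w \notin D ->
  indep M (u |: (w |: D)) -> indep M (v |: D) ->
  indep M (u |: (v |: D)) || indep M (w |: (v |: D)).
Proof.
move=> uw uD wD iuw iv.
have [|t] := indep_aug iv iuw.
  rewrite !cardsU1 !inE negb_or uw uD wD !add1n ltnS.
  by case: (v \notin D); rewrite ?add1n.
rewrite !inE negb_or => /andP[/andP[_ tD]].
by rewrite (negbTE tD) orbF => /orP[]/eqP-> ->; rewrite ?orbT.
Qed.

(** Here [s] is the product p x y * p x' z, as p x y holds by hypothesis, and [t] is p x z * p x' y.
    Nothing is claimed about [e] when both hold. *)
Lemma basis_exchange2 B x x' y z :
  basis M B -> x \in B -> x' \in B -> x != x' ->
  y \notin B -> z \notin B -> y != z ->
  basis M (exchange B x y) ->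
  let e := basis M (exchange (exchange B x y) x' z) in
  let s := basis M (exchange B x' z) in
  let t := basis M (exchange B x z) && basis M (exchange B x' y) in
  (s (+) t ==> e) && (e ==> s || t).
Proof.
move=> bB xB x'B xx' yB zB yz bxy /=.
have x'y : x' != y by apply: contraNneq yB => <-.
have xy : x != y by apply: contraNneq yB => <-.
have xz : x != z by apply: contraNneq zB => <-.
have x'Bxy : x' \in exchange B x y by rewrite !inE [x' == x]eq_sym xx' x'B orbT.
have zBxy : z \notin exchange B x y.
  by rewrite !inE (negbTE zB) andbF orbF eq_sym.
rewrite (basis_exchange bxy) //.
move: bxy; rewrite !basis_exchange // => ixy.
(* Every set involved becomes a pair added to the common part [D]. *)
set D := (B :\ x) :\ x'.
have eBx : B :\ x = x' |: D by rewrite /D setD1K // !inE eq_sym xx'.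
have eBx' : B :\ x' = x |: D.
  apply/setP=> t; rewrite !inE.
  by case: (eqVneq t x) => [->|_] //; rewrite xx'.
have eB : B = x |: (x' |: D) by rewrite -eBx setD1K.
have eBxyz : exchange (exchange B x y) x' z = z |: (y |: D).
  congr (_ |: _).
  apply/setP=> t; rewrite !inE; case: (eqVneq t x') => //= ->.
  by rewrite (negbTE x'y).
move: ixy; rewrite eBxyz /exchange eBx eBx'.
have uD u : u \notin B -> u \notin D.
  by apply: contra; rewrite !inE => /and3P[].
have xD : x \notin D by rewrite !inE eqxx andbF.
have x'D : x' \notin D by rewrite !inE eqxx.
have iB : indep M (x |: (x' |: D)) by rewrite -eB; case/maxsetP: bB.
have single u v : indep M (u |: (v |: D)) -> indep M (u |: D).
  by apply: indep_sub; rewrite setUCA subsetUr.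
have C u v : u |: (v |: D) = v |: (u |: D) by rewrite setUCA.
move=> iyx'.
have yD := uD _ yB; have zD := uD _ zB.
have ix := single _ _ iB; have iy := single _ _ iyx'.
(* If [z] is a loop over [D], then [e], [s] and [t] all fail. *)
have [iz|niz] := boolP (indep M (z |: D)); last first.
  have loop u : indep M (z |: (u |: D)) = false.
    by apply: contraNF niz => /single.
  by rewrite !loop.
(* [T2], [T3] and [T5] force [e] when exactly one product holds; [T1] and [T4] yield [t] from [e]
   when [s] fails. *)
have T1 := @indep_pair_trans D x z x' xx' xD x'D iB iz.
have T2 := @indep_pair_trans D x' z y x'y x'D yD _ iz.
have T3 := @indep_pair_trans D x z y xy xD yD _ iz.
have T4 := @indep_pair_trans D z x y _ zD yD _ ix.
have T5 := @indep_pair_trans D z y x _ zD xD _ iy.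
move: T1 T2 T3 T4 T5.
rewrite ![_ |: (z |: D)]C (C x' y) (C x y) iyx' eq_sym yz eq_sym xz.
do 4!case: (indep _ _) => //=; intuition.
Qed.

End Exchange.

Theorem proposition2p5 (T : finType) (M : matroid T) (A B : {set T}) (a b : T) :
  basis M A -> basis M B -> [disjoint A & B] ->
  a \in A -> b \in Sym M a A B ->
  forall a' : T, a' \in A :\ a ->
  let Aab := exchange A a b in
  let Bba := exchange B b a in
  [/\ b \notin fund_circuit M a' B -> a' \notin fund_circuit M b A ->
        Sym M a' Aab Bba = Sym M a' A B,
      b \in fund_circuit M a' B -> a' \notin fund_circuit M b A ->
        (Sym M a' A B :+: Conn M a a' A B \subset Sym M a' Aab Bba) /\
        (Sym M a' Aab Bba \subset Sym M a' A B :|: Conn M a a' A B),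
      b \notin fund_circuit M a' B -> a' \in fund_circuit M b A ->
        (Sym M a' A B :+: Conn M a' a A B \subset Sym M a' Aab Bba) /\
        (Sym M a' Aab Bba \subset Sym M a' A B :|: Conn M a' a A B)
    & b \in fund_circuit M a' B -> a' \in fund_circuit M b A ->
        (a |: (Sym M a' A B :+: Sym M a A B :+: Conn M a' a A B
                 :+: Conn M a a' A B) \subset Sym M a' Aab Bba) /\
        (Sym M a' Aab Bba \subset
           a |: (Sym M a' A B :|: Sym M a A B :|: Conn M a' a A B
                   :|: Conn M a a' A B))].
Proof.
move=> bA bB dAB aA bS a' a'A Aab Bba.
move: bS; rewrite inE => /and3P[bB' Pab Qba].
move: a'A; rewrite !inE => /andP[a'a a'A].
have aB := disjointFr dAB aA; have a'B := disjointFr dAB a'A.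
have bA' := disjointFl dAB bB'.
rewrite !mem_fund_circuit ?aB ?a'B ?bA' //.
(* [a] is the only element of [Bba] outside [B]. It belongs to the new [Sym] exactly when both
   hypotheses of case (iv) hold. *)
have swapA : exchange Aab a' a = exchange A a' b.
  apply/setP=> t; rewrite !inE.
  case: (eqVneq t a) => [->|_] /=; first by rewrite [a == a']eq_sym a'a aA orbT.
  case: (eqVneq t b) => [->|_] //=.
  by rewrite andbT; apply: contraFneq bA' => ->.
have swapB : exchange Bba a a' = exchange B b a'.
  apply/setP=> t; rewrite !inE.
  case: (eqVneq t a) => [->|_] //=.
  by rewrite aB andbF.
have memS c : (c \in Sym M a' Aab Bba) =
    if c == a then basis M (exchange A a' b) && basis M (exchange B b a')
    else [&& c != b, c \in B, basis M (exchange Aab a' c)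
           & basis M (exchange Bba c a')].
  by rewrite !inE; case: eqVneq => [->|_] /=; rewrite ?swapA ?swapB // -andbA.
(* Multiplying the two-term expressions of [detA] and [detB] gives the two [Sym] and two [Conn]
   terms; the case hypotheses decide which survive. *)
have detA c (cB : c \in B) (cb : b != c) := basis_exchange2 bA aA a'A
  (ltac:(by rewrite eq_sym)) (negbT bA') (negbT (disjointFl dAB cB)) cb Pab.
have detB c (cB : c \in B) (bc : b != c) := basis_exchange2 bB bB' cB
  bc (negbT aB) (negbT a'B) (ltac:(by rewrite eq_sym)) Qba.
move: memS detA detB Pab Qba; rewrite -/Aab -/Bba => memS detA detB Pab Qba.
split=> [/negbTE ha' /negbTE hb|ha' /negbTE hb|/negbTE ha' hb|ha' hb];
  (apply/setP=> c || (split; apply/subsetP=> c)); rewrite memS !inE ?ha' ?hb;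
  (case: (eqVneq c a) => [->|_]; first by rewrite ?aB);
  (* [b] is not in [Bba]. It lies in none of the sets combined in (i) to (iii), and in all four of
     (iv), where it cancels. *)
  (case: (eqVneq c b) => [->|cb] /=;
    first by rewrite ?bB' ?ha' ?hb -/Aab -/Bba ?Pab ?Qba ?andbF);
  (case: (boolP (c \in B)) => [cB|_] //=);
  rewrite eq_sym in cb; have := detA c cB cb; have := detB c cB cb;
  rewrite /= ?ha' ?hb;
  do 6?[case: (basis _ _) => //=].
Qed.
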